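(* Let $n\ge 3$ be an integer, let $\ell$ be a positive integer and let $r_1,\dots,r_\ell$ be a sequence of positive integers. Assume that $\sum_{i=1}^{\ell}r_i\le n$; if $r_j=1$ for some $j$, assume additionally that $\sum_{i=1}^{\ell}r_i<n$. Then $Z^0(n,\ell;r_1,\dots,r_\ell)$ contains the polynomial $g(x)=x^n$, and therefore is nonempty.
   Context: $\mathbf{A}^n=\mathbb{C}^n$ denotes the affine space of all monic complex polynomials $g(x)=x^n+\sum_{i=0}^{n-1}a_ix^i$ of degree $n$, identified with their coefficient vectors $(a_0,\dots,a_{n-1})\in\mathbb{C}^n$. For a positive integer $r$, $g^{\circ r}$ denotes the $r$-fold composition of $g$ with itself. $Z_{n,r}\subset\mathbf{A}^n$ is the (Zariski-open, dense) set of all monic degree $n$ polynomials $g$ such that $g^{\circ r}(x)-x$ has no multiple roots. $Z(n,\ell;r_1,\dots,r_\ell):=\bigcap_{i=1}^{\ell}Z_{n,r_i}$; it is a Zariski-open subset of $\mathbf{A}^n$ containing $x^n$. Let $g_0\in Z(n,\ell;r_1,\dots,r_\ell)$. If $\beta\in\mathbb{C}$ is a periodic point of $z\mapsto g_0(z)$ of exact period $r=r_i$, then $\beta$ is a simple root of $g_0^{\circ r}(x)-x$, so by the implicit function theorem it extends uniquely to a holomorphic function $g\mapsto\beta(g)$ of the coefficients $(a_0,\dots,a_{n-1})$ in a neighbourhood of $g_0$ with $g^{\circ r}(\beta(g))=\beta(g)$ and $\beta(g_0)=\beta$. Define, near $g_0$, the holomorphic function $\mathrm{Mult}_{\beta,r}(g):=[g^{\circ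 r}]'(\beta(g))$, and let $\mathrm{grad}(\mathrm{Mult}_{\beta,r})|_{g_0}\in\mathbb{C}^n$ be its vector of partial derivatives with respect to $a_0,\dots,a_{n-1}$ at $g_0$. $Z^0(n,\ell;r_1,\dots,r_\ell)$ is the set of all $g_0\in Z(n,\ell;r_1,\dots,r_\ell)$ such that, for every choice of $\beta_1,\dots,\beta_\ell\in\mathbb{C}$ with $\beta_i$ a periodic point of $z\mapsto g_0(z)$ of exact period $r_i$ for each $i$ and with $\beta_1,\dots,\beta_\ell$ lying in pairwise distinct orbits of $z\mapsto g_0(z)$, the $\ell$ vectors $\mathrm{grad}(\mathrm{Mult}_{\beta_i,r_i})|_{g_0}$ ($1\le i\le\ell$) are linearly independent in $\mathbb{C}^n$. *)

(* Defs.v *)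
From mathcomp Require Import all_boot all_order all_algebra.
From mathcomp Require Import complex.
From mathcomp Require Import all_classical all_reals all_analysis.

Set Implicit Arguments.
Unset Strict Implicit.
Unset Printing Implicit Defensive.

Import Order.TTheory GRing.Theory Num.Theory.
Import numFieldNormedType.Exports.

Local Open Scope classical_set_scope.
Local Open Scope ring_scope.

(* The bundled type [numClosedFieldType], rather than the bare [R[i]], is what
   gives access to the library's topology and complex differentiation. *)
Definition cplx (R : realType) : numClosedFieldType := R[i].

Section Multipliers.
Variables (R : realType) (n : nat).
Notation C := (cplx R).

Definition affine_space : set {poly C} :=
  [set g | g \is monic /\ size g = n.+1].

(* Coordinates (a_0, ..., a_(n-1)) on [affine_space] are given by [poly_rV],
   which keeps the coefficients of degree < n; this is its inverse. *)
Definition poly_of (a : 'rV[C]_n) : {poly C} := 'X^n + rVpoly a.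

Definition iter_poly (r : nat) (g : {poly C}) : {poly C} :=
  iter r (comp_poly g) 'X.

Definition multiple_root (p : {poly C}) (x : C) : bool :=
  ('X - x%:P) ^+ 2 %| p.

Definition Zset (r : nat) : set {poly C} :=
  affine_space `&`
  [set g | forall x, ~~ multiple_root (iter_poly r g - 'X) x].

Definition exact_period (g : {poly C}) (r : nat) (x : C) : Prop :=
  [/\ (0 < r)%N, iter r (horner g) x = x
    & forall k, (0 < k < r)%N -> iter k (horner g) x != x].

Definition forward_orbit (g : {poly C}) (x : C) : set C :=
  [set y | exists k, y = iter k (horner g) x].

Definition is_periodic_branch (r : nat) (g0 : {poly C}) (beta : C)
    (b : 'rV[C]_n -> C) : Prop :=
  b (poly_rV g0) = beta /\
  \forall a \near poly_rV g0,
    differentiable b a /\ (iter_poly r (poly_of a)).[b a] = b a.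

(* A chosen branch. When [beta] is a simple root of [iter_poly r g0 - 'X], its
   germ at [g0] is unique by the implicit function theorem, so the choice does
   not matter; the default [fun=> beta] is only used if there is no branch. *)
Definition periodic_branch (r : nat) (g0 : {poly C}) (beta : C) :
    'rV[C]_n -> C :=
  xget (fun=> beta) [set b | is_periodic_branch r g0 beta b].

Definition Mult (r : nat) (g0 : {poly C}) (beta : C) (a : 'rV[C]_n) : C :=
  (iter_poly r (poly_of a))^`().[periodic_branch r g0 beta a].

Definition grad_Mult (r : nat) (g0 : {poly C}) (beta : C) : 'rV[C]_n :=
  \row_(j < n) 'D_(delta_mx 0 j) (Mult r g0 beta) (poly_rV g0).

Definition Zinter (l : nat) (r : 'I_l -> nat) : set {poly C} :=
  \bigcap_(i in [set: 'I_l]) Zset (r i).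

Definition Z0 (l : nat) (r : 'I_l -> nat) : set {poly C} :=
  Zinter r `&`
  [set g0 | forall beta : 'I_l -> C,
     (forall i, exact_period g0 (r i) (beta i)) ->
     (forall i j, i != j ->
        forward_orbit g0 (beta i) <> forward_orbit g0 (beta j)) ->
     row_free (\matrix_(i < l) grad_Mult (r i) g0 (beta i))].

End Multipliers.

(* Main.v *)
Require Import Defs.
From mathcomp Require Import all_boot all_order all_algebra.
From mathcomp Require Import complex.
From mathcomp Require Import all_classical all_reals all_analysis.
From mathcomp Require Import ring.

Set Implicit Arguments.
Unset Strict Implicit.
Unset Printing Implicit Defensive.

Import Order.TTheory GRing.Theory Num.Theory.
Import numFieldNormedType.Exports.

Local Open Scope classical_set_scope.
Local Open Scope ring_scope.

(** Let [x_0, ..., x_(r-1)] be a nonzero periodic orbit of [x^n], and let [v_k]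
    be the derivative of [x_k] in the direction [a_j], so that
    [v_(k+1) = n x_k^(n-1) v_k + x_k^j].  Then [w_k = v_k / x_k] satisfies
    [w_(k+1) = n w_k + x_k^j / x_k^n], and summing over the orbit gives
    [(n - 1) sum w_k = - sum x_k^j / x_k^n].  Logarithmic differentiation of the
    multiplier turns this into
      [dMult/da_j = Mult * (j/n - 1) * sum x_k^j / x_k^n],
    whereas at the fixed point [0] the gradient is the basis vector of [a_1].
    Hence a linear relation between the gradients can be tested against every
    polynomial [q] of degree [< n].  The product of the [X - z] over all the
    points [z] of the orbits but one isolates a single coefficient; when [0] is
    one of the points, an additional factor [X] ensures [q_1 = 0], at the cost
    of one degree.

    The holomorphic branch of periodic points exists because a simple root of a
    monic polynomial depends differentiably on the coefficients: continuity
    comes from [|p(z)| = prod |z - z_i|], differentiability from the fact that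
    the difference quotient of [p] does not vanish near a simple root. *)

(** * Simple roots of monic polynomials depending on a parameter *)

(** If all roots kept distance at least [e] from [z], each linear factor of [p.[z]] would have norm
    at least [e], contradicting the bound. *)
Lemma monic_root_near (C : numClosedFieldType) (p : {poly C}) (z e : C) :
  p \is monic -> 0 <= e -> `|p.[z]| < e ^+ (size p).-1 ->
  exists2 x, root p x & `|z - x| < e.
Proof.
move=> pm e0 pz; have [s ps] := closed_field_poly_normal p.
move: pm ps => /monicP ->; rewrite scale1r => ps.
have [/hasP[x xs zx]|/hasPn Ns] := boolP (has (fun x => `|z - x| < e) s).
  by exists x; rewrite // ps root_prod_XsubC.
have : e ^+ (size p).-1 <= `|p.[z]|.
  rewrite {}ps size_prod_XsubC /= horner_prod normr_prod => {pz}.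
  elim: s Ns => [|x s IHs] Ns; first by rewrite big_nil.
  rewrite big_cons exprS hornerXsubC ler_pM ?exprn_ge0//.
    by rewrite real_leNgt ?normr_real ?ger0_real// Ns// mem_head.
  by apply: IHs => y ys; apply: Ns; rewrite inE ys orbT.
by rewrite real_leNgt ?normr_real ?ger0_real ?exprn_ge0// pz.
Qed.

(** * Differentiability of products with a merely continuous factor *)

Section DifferentiableMul.
Context {C : numFieldType} {V : normedModType C}.
Implicit Types (f u w : V -> C) (a : V).

Lemma eqo_differentiable f a : f a = 0 ->
  f \o shift a =o_ (0 : V) id -> differentiable f a.
Proof.
move=> fa0 fo; have df : f \o shift a = cst (f a) + \0 +o_ (0 : V) id.
  by rewrite fa0; apply/eqaddoP; rewrite addr0 subr0; apply/eqoP.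
have d0 : continuous (\0 : V -> C) by move=> x; exact: cvg_cst.
apply/diff_locallyP; rewrite (diff_unique d0 df); split=> //.
Qed.

(** The differential is bounded linear, and the remainder is eventually at most [|h|]; this accounts
    for the [k + 1] in the proof. *)
Lemma differentiable_lipschitz u a : u a = 0 -> differentiable u a ->
  exists2 k, 0 < k & \forall h \near 0, `|u (h + a)| <= k * `|h|.
Proof.
move=> ua0 du; have [k k0 kP] := linear_lipschitz (diff_continuous du).
exists (k + 1); first exact: addr_gt0.
have /eqaddoP/(_ 1 ltr01) := diff_locally du.
apply: filter_app; near=> h.
rewrite !fctE /= ua0 add0r mul1r => uh; rewrite -[u _](subrK ('d u a h)).
by rewrite addrC (le_trans (ler_normD _ _))// mulrDl mul1r lerD.
Unshelve. all: by end_near. Qed.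

(* Only [u] has to be differentiable, because it vanishes at the point. *)
Lemma differentiable_mul_continuous u w a : u a = 0 -> differentiable u a ->
  {for a, continuous w} -> differentiable (fun x => u x * w x) a.
Proof.
move=> ua0 du wc.
(* The last summand is o(h), since [u] is O(h) and [w x - w a] tends to 0. *)
have -> : (fun x => u x * w x) = w a *: u + (fun x => u x * (w x - w a)).
  by apply/funext => x; rewrite !fctE /= /GRing.scale/=; ring.
apply: differentiableD; first exact: differentiableZ.
apply: eqo_differentiable; first by rewrite ua0 mul0r.
have [k k0 uk] := differentiable_lipschitz ua0 du.
apply/eqoP => _/posnumP[e].
have wk : \forall h \near 0, `|w (h + a) - w a| <= e%:num / k.
  have : w \o shift a @ 0 --> w a.
    by rewrite (cvg_comp_shift a) add0r.
  by move/cvgr_distC_le; apply; rewrite divr_gt0.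
near=> h; rewrite /= normrM.
rewrite (_ : e%:num * _ = k * `|h| * (e%:num / k)); last first.
  by field; rewrite gt_eqF.
by rewrite ler_pM//; near: h.
Unshelve. all: by end_near. Qed.

End DifferentiableMul.

Lemma near_eq_differentiable (K : numFieldType) (V W : normedModType K)
    (f g : V -> W) (a : V) :
  (\near a, f a = g a) -> differentiable f a -> differentiable g a.
Proof.
move=> fg df; have gd : g \o shift a = cst (g a) + 'd f a +o_ (0 : V) id.
  rewrite -(nbhs_singleton fg); apply/eqaddoP => e e0.
  have /eqaddoP/(_ e e0) := diff_locally df.
  apply: filter_app; move: fg; rewrite (near_shift 0) subr0.
  by apply: filterS => h /= fg; rewrite !fctE/= fg.
apply/diff_locallyP; rewrite (diff_unique (diff_continuous df) gd).
by split=> //; exact: diff_continuous.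
Qed.

(** The divided difference [(p.[x] - p.[y]) / (x - y)], expanded as a polynomial in both points so
    that it makes sense for [x = y]. At [i = 0] the inner sum is empty, so the truncated [i.-1] is
    harmless. *)
Definition diffquot (K : nzRingType) (p : {poly K}) (x y : K) : K :=
  \sum_(i < size p) p`_i * \sum_(k < i) x ^+ (i.-1 - k) * y ^+ k.

Lemma diffquotP (K : comNzRingType) (p : {poly K}) (x y : K) :
  p.[x] - p.[y] = (x - y) * diffquot p x y.
Proof.
rewrite !horner_coef -sumrB mulr_sumr; apply: eq_bigr => i _.
by rewrite -mulrBr subrXX mulrCA.
Qed.

Lemma diffquotxx (K : comNzRingType) (p : {poly K}) (x : K) :
  diffquot p x x = p^`().[x].
Proof.
rewrite -[in RHS](coefK p) poly_def raddf_sum/= horner_sum.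
apply: eq_bigr => i _; rewrite derivZ hornerZ derivXn hornerMn hornerXn.
congr (_ * _); rewrite (eq_bigr (fun=> x ^+ i.-1)) ?sumr_const ?card_ord//.
move=> k _; rewrite -exprD subnK// -ltnS prednK//.
exact: leq_ltn_trans (ltn_ord k).
Qed.

Section Cvg.
Context {K : numFieldType} {T : Type} {F : set_system T} {FF : Filter F}.

Lemma cvgX (f : T -> K) (a : K) n :
  f @ F --> a -> (fun t => f t ^+ n) @ F --> a ^+ n.
Proof.
move=> fa; elim: n => [|n IHn]; first exact: cvg_cst.
by rewrite exprS; under eq_fun do rewrite exprS; exact: cvgM.
Qed.

Lemma cvg_sumr (I : Type) (r : seq I) (f : I -> T -> K) (a : I -> K) :
  (forall i, f i @ F --> a i) ->
  (fun t => \sum_(i <- r) f i t) @ F --> \sum_(i <- r) a i.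
Proof. by move=> fa; apply: cvg_big => //; exact: add_continuous. Qed.

Lemma cvg_diffquot (q : T -> {poly K}) (q0 : {poly K}) (x y : T -> K)
    (x0 y0 : K) :
  (forall t, size (q t) = size q0) ->
  (forall i, (fun t => (q t)`_i) @ F --> q0`_i) ->
  x @ F --> x0 -> y @ F --> y0 ->
  (fun t => diffquot (q t) (x t) (y t)) @ F --> diffquot q0 x0 y0.
Proof.
move=> sq cq cx cy; rewrite /diffquot.
under eq_fun do rewrite sq.
apply: cvg_sumr => i; apply: cvgM => //.
by apply: cvg_sumr => k; apply: cvgM; exact: cvgX.
Qed.

End Cvg.

(** * Implicit function theorem for simple roots *)

Section ImplicitRoot.
Context {C : numClosedFieldType} {V : normedModType C}.
Variables (p : V -> {poly C}) (N : nat).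
Hypothesis p_monic : forall a, p a \is monic.
Hypothesis size_p : forall a, size (p a) = N.+1.
Hypothesis p_diff : forall i a, differentiable (fun a => (p a)`_i : C) a.

Let horner_diff (x : C) a : differentiable (fun a => (p a).[x] : C) a.
Proof.
under eq_fun do rewrite horner_coef size_p.
rewrite (_ : (fun _ => _) = \sum_(i < N.+1) (fun a => (p a)`_i * x ^+ i)).
  apply: differentiable_sum => i.
  by apply: differentiableM => //; exact: differentiable_cst.
by apply/funext => b; rewrite fct_sumE.
Qed.

Let root_near (a : V) (x : C) (P : set C) :
  root (p a) x -> nbhs x P ->
  \forall b \near a, exists2 y, root (p b) y & P y.
Proof.
move=> /rootP pax /nbhs_ballP[e/= e0 eP].
have : (fun b => (p b).[x] : C) @ a --> (p a).[x].
  exact: (differentiable_continuous (horner_diff x a)).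
rewrite pax => /cvgr_norm_lt.
move=> /(_ (e ^+ N)); rewrite normr0 exprn_gt0// => /(_ isT).
apply: filterS => b pbx.
have [|y py xy] := @monic_root_near _ (p b) x e (p_monic b) (ltW e0).
  by rewrite size_p.
by exists y => //; apply: eP; rewrite -ball_normE.
Qed.

Lemma implicit_root (a0 : V) (x0 : C) :
  root (p a0) x0 -> (p a0)^`().[x0] != 0 ->
  exists b : V -> C, b a0 = x0 /\
    \forall a \near a0, differentiable b a /\ root (p a) (b a).
Proof.
move=> px0 dpx0.
(* On the diagonal the difference quotient is the nonzero derivative, so by continuity it stays
   nonzero nearby, where two distinct roots are then impossible. *)
have [e /= e0 eQ] : exists2 e : C, 0 < e & forall a x y,
    ball a0 e a -> ball x0 e x -> ball x0 e y -> diffquot (p a) x y != 0.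
  have : (fun t : V * (C * C) => diffquot (p t.1) t.2.1 t.2.2) @
      (a0, (x0, x0)) --> diffquot (p a0) x0 x0.
    apply: cvg_diffquot.
    - by move=> t; rewrite !size_p.
    - move=> i.
      apply: (@cvg_comp _ _ _ fst (fun a => (p a)`_i : C) _ (nbhs a0)).
        exact: cvg_fst.
      exact: (differentiable_continuous (p_diff i a0)).
    - by apply: (@cvg_comp _ _ _ snd fst); [exact: cvg_snd|exact: cvg_fst].
    - by apply: (@cvg_comp _ _ _ snd snd); [exact: cvg_snd|exact: cvg_snd].
  rewrite diffquotxx => /cvgr_neq0/(_ dpx0)/nbhs_ballP[e/= e0 eQ].
  by exists e => // a x y ax xx yx; apply: (eQ (a, (x, y))).
have root_uniq a x y : ball a0 e a -> ball x0 e x -> ball x0 e y ->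
    root (p a) x -> root (p a) y -> x = y.
  move=> ba bx by_ /rootP rx /rootP ry; have := diffquotP (p a) x y.
  rewrite rx ry subrr => /esym/eqP; rewrite mulf_eq0 subr_eq0.
  by rewrite (negPf (eQ _ _ _ ba bx by_)) orbF => /eqP.
pose R a := [set x | ball x0 e x /\ root (p a) x].
(* The default [x0] is taken only where [R a] is empty, which does not happen near [a0]. *)
pose b a := xget x0 (R a).
have bE a x : ball a0 e a -> R a x -> b a = x.
  move=> ba Rx; have [bx brx] : R a (b a) by exact: xgetI Rx.
  by case: Rx => ? ?; apply: (root_uniq a).
have ball_nbhs x : ball x0 e x -> nbhs x (ball x0 e).
  by move=> xe; apply: open_nbhs_nbhs; split=> //; exact: ball_open.
exists b; split.
  by apply: bE; [exact: ballxx|split=> //; exact: ballxx].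
have G : \forall a \near a0, ball a0 e a /\ R a !=set0.
  near=> a; split; first by near: a; exact: nbhsx_ballx.
  suff [y py ye] : exists2 y, root (p a) y & ball x0 e y by exists y.
  by near: a; apply: (root_near px0); exact: nbhsx_ballx.
(* Differentiability at a point [a] near [a0] needs roots for all parameters in a neighbourhood of
   [a]. *)
have GG : \forall a \near a0, \forall a' \near a, ball a0 e a' /\ R a' !=set0.
  exact: nbhs_interior.
near=> a.
have {}Ga : \forall a' \near a, ball a0 e a' /\ R a' !=set0 by near: a.
have RbP a' : ball a0 e a' /\ R a' !=set0 -> R a' (b a').
  by move=> [_ [x Rx]]; exact: xgetI Rx.
have [bax0 pba] := RbP _ (nbhs_singleton Ga).
split=> //.
have b_cont : {for a, continuous b}.
  move=> P /= bP; change (\forall a' \near a, P (b a')).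
  (* For [a'] near [a] some root of [p a'] lies in this neighbourhood, and by uniqueness it is
     [b a']. *)
  have nP : nbhs (b a) (ball x0 e `&` P).
    by apply: filterI => //; exact: ball_nbhs.
  apply: filterS2 Ga (root_near pba nP) => a' [aa' _] [y py [yx0 Py]].
  by rewrite /= (bE a' y).
(* As [p a'] vanishes at [b a'], [diffquotP] gives [b a' = b a - (p a').[b a] * w a']. The factor
   [(p a').[b a]] is differentiable and vanishes at [a' = a], so continuity of [w] suffices. *)
pose w a' := (diffquot (p a') (b a') (b a))^-1.
have : differentiable (fun a' => b a - (p a').[b a] * w a') a.
  apply: (@differentiableB _ _ _ (cst (b a))); first exact: differentiable_cst.
  apply: differentiable_mul_continuous => //; first exact/rootP.
  apply: cvgV; first by apply: eQ => //; have [] := nbhs_singleton Ga.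
  apply: cvg_diffquot => //.
  - by move=> a'; rewrite !size_p.
  - by move=> i; exact: (differentiable_continuous (p_diff i a)).
  - exact: cvg_cst.
apply: near_eq_differentiable.
move: Ga; apply: filterS => a' Ga'; have [xa' pa'] := RbP _ Ga'.
have Q0 : diffquot (p a') (b a') (b a) != 0 by apply: eQ => //; case: Ga'.
have := diffquotP (p a') (b a') (b a).
rewrite (rootP pa') sub0r => E.
by rewrite /w -mulNr E mulfK// addrC subrK.
Unshelve. all: by end_near. Qed.

End ImplicitRoot.

(** * Branches of periodic points *)

Section CoefDifferentiable.
Context {C : numFieldType} {V : normedModType C}.
Implicit Types p q : V -> {poly C}.

Definition coef_differentiable p :=
  forall i a, differentiable (fun a => (p a)`_i : C) a.

Lemma coef_differentiable_cst (c : {poly C}) : coef_differentiable (fun=> c).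
Proof. by move=> i a; exact: differentiable_cst. Qed.

Lemma coef_differentiableD p q : coef_differentiable p ->
  coef_differentiable q -> coef_differentiable (fun a => p a + q a).
Proof.
move=> dp dq i a; under eq_fun do rewrite coefD.
by apply: differentiableD; [exact: dp|exact: dq].
Qed.

Lemma coef_differentiable_sum n (p : 'I_n -> V -> {poly C}) :
  (forall i, coef_differentiable (p i)) ->
  coef_differentiable (fun a => \sum_(i < n) p i a).
Proof.
move=> dp i a; under eq_fun do rewrite coef_sum.
rewrite (_ : (fun _ => _) = \sum_(j < n) (fun a => (p j a)`_i)).
  by apply: differentiable_sum => j; exact: dp.
by apply/funext => b; rewrite fct_sumE.
Qed.

Lemma coef_differentiableM p q : coef_differentiable p ->
  coef_differentiable q -> coef_differentiable (fun a => p a * q a).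
Proof.
move=> dp dq i a; under eq_fun do rewrite coefM.
rewrite (_ : (fun _ => _) =
    \sum_(j < i.+1) (fun a => (p a)`_j * (q a)`_(i - j))).
  apply: differentiable_sum => j.
  by apply: differentiableM; [exact: dp|exact: dq].
by apply/funext => b; rewrite fct_sumE.
Qed.

Lemma coef_differentiableX p n : coef_differentiable p ->
  coef_differentiable (fun a => p a ^+ n).
Proof.
move=> dp; elim: n => [|n IHn]; first exact: coef_differentiable_cst.
by under eq_fun do rewrite exprS; exact: coef_differentiableM.
Qed.

(** The constant size makes the composition a sum over an index range independent of the
    parameter. *)
Lemma coef_differentiable_comp p q N : (forall a, size (p a) = N) ->
  coef_differentiable p -> coef_differentiable q ->
  coef_differentiable (fun a => p a \Po q a).
Proof.
move=> sp dp dq; under eq_fun do rewrite comp_polyE sp.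
apply: coef_differentiable_sum => i.
under eq_fun do rewrite -mul_polyC.
apply: coef_differentiableM; last exact: coef_differentiableX.
move=> j a; under eq_fun do rewrite coefC.
by case: eqP => _; [exact: dp|exact: differentiable_cst].
Qed.

End CoefDifferentiable.

(** * Iterates of monic polynomials and their periodic branches *)

Section Iterates.
Variables (R : realType) (n : nat).
Hypothesis n_gt1 : (1 < n)%N.
Notation C := (cplx R).
Implicit Types (a : 'rV[C]_n) (g : {poly C}).

Lemma iter_polyS r g : iter_poly r.+1 g = iter_poly r g \Po g.
Proof. by []. Qed.

Lemma horner_iter_poly r g x : (iter_poly r g).[x] = iter r (horner g) x.
Proof.
elim: r x => [|r IHr] x; first by rewrite hornerX.
by rewrite iter_polyS horner_comp IHr iterSr.
Qed.

Lemma size_iter_poly r g : g \is monic -> size g = n.+1 ->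
  size (iter_poly r g) = (n ^ r).+1 /\ iter_poly r g \is monic.
Proof.
move=> gm sg; elim: r => [|r [sr mr]]; first by rewrite size_polyX monicX.
have mP : iter_poly r.+1 g \is monic.
  rewrite iter_polyS.
  rewrite monicE.
  have s1 : (1 < size g)%N by rewrite sg ltnS ltnW.
  rewrite (lead_coef_comp _ s1).
  rewrite (monicP gm).
  rewrite (monicP mr).
  by rewrite expr1n mulr1.
split=> //; rewrite -[LHS]prednK ?size_poly_gt0 ?monic_neq0//.
by rewrite iter_polyS size_comp_poly sg sr mulnC expnS.
Qed.

Lemma size_iter_poly_subX r g : (0 < r)%N -> g \is monic -> size g = n.+1 ->
  size (iter_poly r g - 'X) = (n ^ r).+1 /\ iter_poly r g - 'X \is monic.
Proof.
move=> r0 gm sg; have [sr mr] := size_iter_poly r gm sg.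
have sX : (size (- 'X : {poly C}) < size (iter_poly r g))%N.
  rewrite size_polyN size_polyX sr ltnS.
  by have := ltn_exp2l 0 r n_gt1; rewrite expn0 r0.
by rewrite monicE lead_coefDl// (monicP mr) size_polyDl.
Qed.

Lemma size_poly_of a : size (poly_of a) = n.+1.
Proof. by rewrite size_polyDl size_polyXn// ltnS size_poly. Qed.

Lemma monic_poly_of a : poly_of a \is monic.
Proof.
by rewrite monicE lead_coefDl ?lead_coefXn// size_polyXn ltnS size_poly.
Qed.

Lemma poly_of_poly_rV g : g \is monic -> size g = n.+1 ->
  poly_of (poly_rV g : 'rV_n) = g.
Proof.
move=> gm sg; apply/polyP => i; rewrite coefD coefXn coef_rVpoly.
case: insubP => [j ji <-|]; first by rewrite mxE (ltn_eqF (ltn_ord j)) add0r.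
rewrite -leqNgt leq_eqVlt addr0 => /orP[/eqP <-|ni].
  by rewrite eqxx; move/monicP: gm; rewrite /lead_coef sg.
by rewrite gtn_eqF// nth_default// sg.
Qed.

Lemma coef_differentiable_poly_of :
  coef_differentiable (fun a => poly_of a).
Proof.
apply: coef_differentiableD; first exact: coef_differentiable_cst.
move=> i a; under eq_fun do rewrite coef_rVpoly.
case: insubP => [j _ _|_]; last exact: differentiable_cst.
exact: differentiable_coord.
Qed.

Lemma coef_differentiable_iter_poly r :
  coef_differentiable (fun a => iter_poly r (poly_of a)).
Proof.
elim: r => [|r IHr]; first exact: coef_differentiable_cst.
apply: (@coef_differentiable_comp _ _ _ _ (n ^ r).+1) => //.
  by move=> a; case: (size_iter_poly r (monic_poly_of a) (size_poly_of a)).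
exact: coef_differentiable_poly_of.
Qed.

(** A multiplier different from 1 makes [beta] a simple root of [iter_poly r g - 'X]. Existence of
    one branch is enough for [xget] to return a genuine one. *)
Lemma periodic_branchP r g (beta : C) : (0 < r)%N ->
  g \is monic -> size g = n.+1 ->
  (iter_poly r g).[beta] = beta -> (iter_poly r g)^`().[beta] != 1 ->
  is_periodic_branch r g beta (@periodic_branch R n r g beta).
Proof.
move=> r0 gm sg gb dgb; pose p a := iter_poly r (poly_of a) - 'X.
have gE := poly_of_poly_rV gm sg.
have pP a := size_iter_poly_subX r0 (monic_poly_of a) (size_poly_of a).
have dp : coef_differentiable p.
  apply: coef_differentiableD; last exact: coef_differentiable_cst.
  exact: coef_differentiable_iter_poly.
have [b [bg bP]] : exists b : 'rV[C]_n -> C, b (poly_rV g) = beta /\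
    \forall a \near (poly_rV g : 'rV_n), differentiable b a /\ root (p a) (b a).
  apply: (@implicit_root _ _ p (n ^ r)).
  - by move=> a; case: (pP a).
  - by move=> a; case: (pP a).
  - exact: dp.
  - by rewrite /root/p gE hornerD hornerN hornerX gb subrr.
  - by rewrite /p gE derivB derivX hornerD hornerN hornerC subr_eq0.
apply: (@xgetI _ _ _ b); split=> //.
apply: filterS bP => a [db /rootP pab]; split=> //.
by apply/eqP; rewrite -subr_eq0 -{2}[b a](hornerX (b a)) -hornerN -hornerD pab.
Qed.

End Iterates.

(** * The gradient of a multiplier at [x^n] *)

Lemma is_derive_coord (K : numFieldType) m n (a v : 'M[K]_(m, n)) i j :
  is_derive a v (fun b : 'M[K]_(m, n) => b i j : K) (v i j).
Proof.
have E : \forall h \near 0^',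
    h^-1 *: (((fun b : 'M[K]_(m, n) => b i j : K) \o shift a) (h *: v) - a i j)
      = v i j.
  near=> h; rewrite /= !mxE addrK /GRing.scale/= mulrA mulVf ?mul1r//.
  by near: h; exact: nbhs_dnbhs_neq.
split; first by apply: (is_cvg_near_cst (v i j)).
by apply/lim_near_cst.
Unshelve. all: by end_near. Qed.

Lemma is_derive_exprn (K : numFieldType) (V : normedModType K) (f : V -> K)
    (x v : V) (df : K) n : is_derive x v f df ->
  is_derive x v (fun y => f y ^+ n) (n%:R * f x ^+ n.-1 * df).
Proof. by move=> ?; rewrite -exprfctE; exact: is_deriveX. Qed.

(** At the origin the coefficients [a 0 i] vanish, so only their own variation contributes and [dy]
    drops out. *)
Lemma is_derive_linear_comb (K : numFieldType) n (v : 'rV[K]_n)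
    (y : 'rV[K]_n -> K) (dy : K) (c : 'I_n -> K) (e : 'I_n -> nat) :
  is_derive (0 : 'rV[K]_n) v y dy ->
  is_derive (0 : 'rV[K]_n) v (fun a => \sum_(i < n) a 0 i * (c i * y a ^+ e i))
    (\sum_(i < n) v 0 i * (c i * y 0 ^+ e i)).
Proof.
move=> ydy.
rewrite (_ : (fun _ => _) =
    \sum_(i < n) (fun a : 'rV[K]_n => a 0 i * (c i * y a ^+ e i))); last first.
  by apply/funext => b; rewrite fct_sumE.
apply: is_derive_sum => i.
apply: (is_derive_eq (is_deriveM (is_derive_coord 0 v 0 i)
  (is_deriveM (is_derive_cst (c i) 0 v) (is_derive_exprn (e i) ydy)))).
by rewrite mxE scale0r add0r /GRing.scale/= mulrC.
Qed.

Section Gradient.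
Variables (R : realType) (n : nat).
Hypothesis n_gt2 : (2 < n)%N.
Notation C := (cplx R).
Implicit Types (a v : 'rV[C]_n) (y : 'rV[C]_n -> C).

Lemma poly_rVXn : poly_rV ('X^n : {poly C}) = 0 :> 'rV_n.
Proof. by apply/rowP => j; rewrite !mxE coefXn ltn_eqF. Qed.

Lemma poly_of0 : poly_of (0 : 'rV[C]_n) = 'X^n.
Proof. by rewrite /poly_of raddf0 addr0. Qed.

Lemma poly_ofE a : poly_of a = 'X^n + \sum_(i < n) a 0 i *: 'X^i.
Proof.
congr (_ + _); rewrite /rVpoly poly_def; apply: eq_bigr => i _.
by rewrite insubT//= => ilt; congr (a 0 _ *: _); exact: val_inj.
Qed.

Lemma horner_poly_of a (x : C) :
  (poly_of a).[x] = x ^+ n + \sum_(i < n) a 0 i * (1 * x ^+ i).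
Proof.
rewrite poly_ofE hornerD hornerXn horner_sum; congr (_ + _).
by apply: eq_bigr => i _; rewrite hornerZ hornerXn mul1r.
Qed.

Lemma horner_deriv_poly_of a (x : C) : (poly_of a)^`().[x] =
  n%:R * x ^+ n.-1 + \sum_(i < n) a 0 i * (i%:R * x ^+ i.-1).
Proof.
rewrite poly_ofE derivD derivXn hornerD hornerMn hornerXn mulr_natl.
rewrite raddf_sum horner_sum; congr (_ + _); apply: eq_bigr => i _ /=.
by rewrite derivZ hornerZ derivXn hornerMn hornerXn mulr_natl.
Qed.

Lemma sum_delta_mx (f : 'I_n -> C) (j : 'I_n) :
  \sum_(i < n) (delta_mx 0 j : 'rV[C]_n) 0 i * f i = f j.
Proof.
rewrite (bigD1 j)//= big1 ?addr0 ?mxE ?eqxx ?mul1r// => i ij.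
by rewrite mxE (negPf ij) andbF mul0r.
Qed.

(** The first term comes from moving the point, the second from moving the coefficient [a_j]. *)
Lemma is_derive_poly_of y (dy : C) (j : 'I_n) :
  is_derive (0 : 'rV[C]_n) (delta_mx 0 j) y dy ->
  is_derive (0 : 'rV[C]_n) (delta_mx 0 j) (fun a => (poly_of a).[y a])
    (n%:R * y 0 ^+ n.-1 * dy + y 0 ^+ j).
Proof.
move=> ydy; under eq_fun do rewrite horner_poly_of.
apply: (is_derive_eq (is_deriveD (is_derive_exprn n ydy)
  (is_derive_linear_comb (fun=> 1) (fun i => i : nat) ydy))).
by rewrite sum_delta_mx mul1r.
Qed.

Lemma is_derive_deriv_poly_of y (dy : C) (j : 'I_n) :
  is_derive (0 : 'rV[C]_n) (delta_mx 0 j) y dy ->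
  is_derive (0 : 'rV[C]_n) (delta_mx 0 j) (fun a => (poly_of a)^`().[y a])
    (n%:R * (n.-1%:R * y 0 ^+ n.-2 * dy) + j%:R * y 0 ^+ j.-1).
Proof.
move=> ydy; under eq_fun do rewrite horner_deriv_poly_of.
have dX : is_derive (0 : 'rV[C]_n) (delta_mx 0 j)
    (fun a => n%:R * y a ^+ n.-1) (n%:R * (n.-1%:R * y 0 ^+ n.-2 * dy)).
  exact: (is_deriveZ n%:R (is_derive_exprn n.-1 ydy)).
apply: (is_derive_eq (is_deriveD dX
  (is_derive_linear_comb (fun i => i%:R) (fun i : 'I_n => i.-1) ydy))).
by rewrite sum_delta_mx.
Qed.

Lemma iter_poly_Xn r : iter_poly r ('X^n : {poly C}) = 'X^(n ^ r).
Proof.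
by elim: r => [|r IHr]//; rewrite iter_polyS IHr comp_Xn_poly -exprM expnS.
Qed.

Lemma iter_Xn k (x : C) : iter k (horner 'X^n) x = x ^+ (n ^ k).
Proof. by rewrite -horner_iter_poly iter_poly_Xn hornerXn. Qed.

Lemma deriv_iter_poly r (g : {poly C}) x : (iter_poly r g)^`().[x] =
  \prod_(k < r) g^`().[iter k (horner g) x].
Proof.
elim: r x => [|r IHr] x; first by rewrite derivX hornerC big_ord0.
rewrite iter_polyS deriv_comp hornerM horner_comp IHr big_ord_recl mulrC.
by congr (_ * _); apply: eq_bigr => k _; rewrite -iterSr.
Qed.

(** With [N = n ^ r], the derivative is 0 at [x = 0]; otherwise [x ^+ N.-1 = 1] and it equals
    [N > 1]. *)
Lemma deriv_iter_Xn_neq1 r (x : C) : (0 < r)%N -> x ^+ (n ^ r) = x ->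
  ('X^(n ^ r) : {poly C})^`().[x] != 1.
Proof.
move=> r0; have N1 : (1 < n ^ r)%N.
  by rewrite -(expn0 n) ltn_exp2l// ltnW.
rewrite derivXn hornerMn hornerXn; case: (n ^ r)%N N1 => // -[//|N] _ xN.
have [->|x0] := eqVneq x 0; first by rewrite expr0n/= mul0rn eq_sym oner_neq0.
have -> : x ^+ N.+1 = 1 by apply: (mulfI x0); rewrite mulr1 -exprS.
by rewrite pnatr_eq1.
Qed.

Lemma branch_Xn r (beta : C) : (0 < r)%N -> beta ^+ (n ^ r) = beta ->
  is_periodic_branch r 'X^n beta (@periodic_branch R n r 'X^n beta).
Proof.
move=> r0 br; apply: periodic_branchP => //.
- exact: ltnW.
- exact: monicXn.
- by rewrite size_polyXn.
- by rewrite iter_poly_Xn hornerXn.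
- by rewrite iter_poly_Xn deriv_iter_Xn_neq1.
Qed.

End Gradient.

(** * The gradient along a single periodic orbit *)

Section Multiplier.
Variables (R : realType) (n : nat).
Hypothesis n_gt2 : (2 < n)%N.
Notation C := (cplx R).
Variables (r : nat) (beta : C).
Hypothesis r_gt0 : (0 < r)%N.
Hypothesis beta_per : iter r (horner 'X^n) beta = beta.

Let b : 'rV[C]_n -> C := periodic_branch r 'X^n beta.
Let x k : C := iter k (horner 'X^n) beta.
Let xb k (a : 'rV[C]_n) : C := iter k (horner (poly_of a)) (b a).

Let bP : is_periodic_branch r 'X^n beta b.
Proof. by apply: branch_Xn => //; rewrite -iter_Xn. Qed.

Let b0 : b 0 = beta.
Proof. by have [+ _] := bP; rewrite poly_rVXn. Qed.

Let xb0 k : xb k 0 = x k.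
Proof. by rewrite /xb poly_of0 b0. Qed.

Let xS k : x k.+1 = x k ^+ n.
Proof. by rewrite /x iterS hornerXn. Qed.

Section Direction.
Variable j : 'I_n.
Notation "''e'" := (delta_mx 0 j : 'rV[C]_n).

Let xb_derivable k : derivable (xb k) 0 'e.
Proof.
elim: k => [|k IHk].
  have [_ /nbhs_singleton[]] := bP; rewrite poly_rVXn => db _.
  exact: diff_derivable.
exact: (@ex_derive _ _ _ _ _ _ _ (is_derive_poly_of (derivableP IHk))).
Qed.

Let v k : C := 'D_'e (xb k) 0.

Let vS k : v k.+1 = n%:R * x k ^+ n.-1 * v k + x k ^+ j.
Proof.
have h := is_derive_poly_of (derivableP (@xb_derivable k)).
by rewrite -xb0; exact: (@derive_val _ _ _ _ _ _ _ h).
Qed.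

(** The branch equation holds on a whole neighbourhood, so [xb r] and [xb 0] have the same germ.
    This closes up the recursion [vS]. *)
Let v_per : v r = v 0.
Proof.
apply: near_eq_derive; have [_] := bP; rewrite poly_rVXn.
by apply: filterS => a [_]; rewrite horner_iter_poly.
Qed.

Let MultE : @Mult R n r 'X^n beta =
  fun a => \prod_(k < r) (poly_of a)^`().[xb k a].
Proof. by apply/funext => a; rewrite /Mult deriv_iter_poly. Qed.

Lemma grad_Mult_Xn_neq0 : beta != 0 ->
  (@grad_Mult R n r 'X^n beta) 0 j =
  (\prod_(k < r) (n%:R * x k ^+ n.-1)) * (j%:R / n%:R - 1) *
  \sum_(k < r) x k ^+ j / x k ^+ n.
Proof.
move=> beta0; rewrite mxE poly_rVXn MultE.
have n0 : (n%:R : C) != 0 by rewrite pnatr_eq0 -lt0n (ltn_trans _ n_gt2).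
have x0 k : x k != 0 by rewrite /x iter_Xn expf_neq0.
have xn k : x k ^+ n = x k * x k ^+ n.-1.
  by rewrite -exprS prednK// (ltn_trans _ n_gt2).
have xn1 k : x k ^+ n.-1 = x k * x k ^+ n.-2.
  by rewrite -exprS prednK// -subn1 subn_gt0 ltnW.
have xj k : j%:R * x k ^+ j.-1 = j%:R * x k ^+ j / x k.
  case: (nat_of_ord j) => [|i]; first by rewrite !mul0r.
  by rewrite exprS; field.
pose w k := v k / x k.
pose t k := x k ^+ j / x k ^+ n.
have wS k : w k.+1 = n%:R * w k + t k.
  rewrite /w /t vS xS mulrDl; congr (_ + _).
  by rewrite xn; field; rewrite x0 expf_neq0.
(* By periodicity, shifting the index does not change the sum of [w]; summing [wS] then gives the
   relation. *)
have sum_w : (n%:R - 1) * (\sum_(k < r) w k) = - \sum_(k < r) t k.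
  have : \sum_(k < r) w k.+1 = \sum_(k < r) w k.
    apply/eqP; rewrite -subr_eq0 -sumrB.
    rewrite -(big_mkord xpredT (fun k => w k.+1 - w k)) telescope_sumr//.
    by rewrite /w v_per /x beta_per subrr.
  under eq_bigr do rewrite wS.
  rewrite big_split/= -mulr_sumr => E.
  by rewrite mulrBl mul1r -[X in _ - X]E; ring.
pose D m := \prod_(k < m) (n%:R * x k ^+ n.-1).
(* The logarithmic derivative of the partial product [D m]: each summand is that of
   [n x^(n-1) + a_j j x^(j-1)] at [x_k]. *)
pose S m := \sum_(k < m) ((n.-1)%:R * w k + j%:R / n%:R * t k).
have dP m : is_derive (0 : 'rV[C]_n) 'e
    (fun a => \prod_(k < m) (poly_of a)^`().[xb k a]) (D m * S m).
  elim: m => [|m IHm].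
    rewrite /S big_ord0 mulr0; under eq_fun do rewrite big_ord0.
    exact: is_derive_cst.
  under eq_fun do rewrite big_ord_recr/=.
  have dm := is_derive_deriv_poly_of (derivableP (@xb_derivable m)).
  apply: (is_derive_eq (is_deriveM IHm dm)).
  have P0 : \prod_(k < m) (poly_of (0 : 'rV[C]_n))^`().[xb k 0] = D m.
    rewrite /D; apply: eq_bigr => k _.
    by rewrite xb0 poly_of0 derivXn hornerMn hornerXn mulr_natl.
  rewrite /D /S !big_ord_recr/= -/(D m) -/(S m) P0 xb0 poly_of0 derivXn.
  rewrite hornerMn hornerXn -(mulr_natl (x m ^+ n.-1)) /GRing.scale/=.
  rewrite /w /t -/(v m) xj xn xn1; field.
  by rewrite n0 x0 expf_neq0.
rewrite (@derive_val _ _ _ _ _ _ _ (dP r)).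
rewrite -/(D r) -mulrA; congr (_ * _).
rewrite /S big_split/= -!mulr_sumr -subn1 natrB ?(ltn_trans _ n_gt2)// sum_w.
by rewrite mulrBl mul1r addrC.
Qed.

Lemma grad_Mult_Xn_0 : r = 1%N -> beta = 0 ->
  (@grad_Mult R n r 'X^n beta) 0 j = (j == 1%N :> nat)%:R.
Proof.
move=> r1 beta0; rewrite mxE poly_rVXn MultE r1.
under eq_fun do rewrite big_ord1.
have dm := is_derive_deriv_poly_of (derivableP (@xb_derivable 0)).
rewrite (@derive_val _ _ _ _ _ _ _ dm) xb0 /x/= beta0.
(* Here [n > 2] matters: the positive power [n.-2] of the point 0 kills the contribution of its
   motion. *)
have n2 : (n.-2 == 0)%N = false by case: n n_gt2 => [|[|[|]]].
rewrite expr0n n2 mulr0 mul0r mulr0 add0r expr0n.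
by case: (nat_of_ord j) => [|[|k]]; rewrite ?mul0r ?mulr0 ?mulr1.
Qed.

End Direction.
End Multiplier.

(** * Linear independence of the gradients *)

Lemma multiple_root_deriv (R : realType) (p : {poly cplx R}) x :
  multiple_root p x -> root p x && root p^`() x.
Proof.
move=> /dvdpP[q ->]; have A0 : ('X - x%:P).[x] = 0 by rewrite hornerXsubC subrr.
rewrite expr2 !derivM derivXsubC !rootE; move: ('X - _) A0 => A A0.
rewrite !(hornerM, hornerD) A0.
by rewrite !(mulr0, mul0r, addr0) eqxx.
Qed.

Lemma forward_orbit_iter (R : realType) (g : {poly cplx R}) r x k : (0 < r)%N ->
  iter r (horner g) x = x ->
  forward_orbit g (iter k (horner g) x) = forward_orbit g x.
Proof.
move=> r0 xr; apply/seteqP; split=> y [m ->].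
  by exists (m + k)%N; rewrite iterD.
(* From the [k]-th iterate, [k * r - k] more steps complete [k] full periods and return to [x]. *)
exists (m + (k * r - k))%N; rewrite -iterD -addnA subnK ?leq_pmulr//.
rewrite iterD; congr (iter m _ _); elim: k => // k IHk.
by rewrite mulSn iterD -IHk.
Qed.

Section Independence.
Variables (R : realType) (n : nat).
Hypothesis n_gt2 : (2 < n)%N.
Notation C := (cplx R).

Lemma Zset_Xn r : (0 < r)%N -> Zset n r ('X^n : {poly C}).
Proof.
move=> r0; split; first by split; [exact: monicXn|rewrite size_polyXn].
move=> x; apply/negP => /multiple_root_deriv/andP[].
rewrite !rootE iter_poly_Xn derivB derivX hornerD hornerN hornerXn hornerX.
rewrite subr_eq0 => /eqP xN; rewrite hornerD hornerN hornerC subr_eq0.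
by apply/negP; exact: deriv_iter_Xn_neq1.
Qed.

Lemma exact_period_Xn0 r : exact_period ('X^n : {poly C}) r 0 -> r = 1%N.
Proof.
move=> [r0 _ min_r]; apply/eqP; rewrite eqn_leq r0 andbT leqNgt.
apply/negP => r1; have := min_r 1%N; rewrite r1 => /(_ isT)/=.
by rewrite hornerXn expr0n (gtn_eqF (ltn_trans _ n_gt2))// eqxx.
Qed.

(** Dividing out [j / n - 1], nonzero because [j < n], turns the gradient into a weighted evaluation
    of [q] on the orbit. *)
Lemma sum_coef_grad_Mult_Xn r (beta : C) (q : {poly C}) : (0 < r)%N ->
  iter r (horner 'X^n) beta = beta -> beta != 0 -> (size q <= n)%N ->
  \sum_(j < n) q`_j * ((@grad_Mult R n r 'X^n beta) 0 j / (j%:R / n%:R - 1)) =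
  (\prod_(k < r) (n%:R * (iter k (horner 'X^n) beta) ^+ n.-1)) *
  \sum_(k < r) q.[iter k (horner 'X^n) beta] /
     iter k (horner 'X^n) beta ^+ n.
Proof.
move=> r0 br beta0 qn.
under [X in _ = _ * X]eq_bigr do rewrite (horner_coef_wide _ qn) mulr_suml.
rewrite exchange_big/= mulr_sumr; apply: eq_bigr => j _.
have jn : (j%:R / n%:R - 1 : C) != 0.
  rewrite subr_eq0; apply/eqP => jn.
  have n0 : (n%:R : C) != 0 by rewrite pnatr_eq0 -lt0n (ltn_trans _ n_gt2).
  move/(congr1 (fun z => z * n%:R)): jn; rewrite divfK// mul1r => /eqP.
  by rewrite eqr_nat ltn_eqF.
rewrite grad_Mult_Xn_neq0//; set c := _ - 1 in jn *.
rewrite (mulrAC _ c) mulfK// mulrCA; congr (_ * _); rewrite mulr_sumr.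
by apply: eq_bigr => k _; rewrite mulrA.
Qed.

Lemma row_free_grad_Mult_Xn l (r : 'I_l -> nat) (beta : 'I_l -> C) :
  (\sum_(i < l) r i <= n)%N ->
  ((exists j, r j = 1%N) -> (\sum_(i < l) r i < n)%N) ->
  (forall i, exact_period 'X^n (r i) (beta i)) ->
  (forall i j, i != j ->
     forward_orbit 'X^n (beta i) <> forward_orbit 'X^n (beta j)) ->
  row_free (\matrix_(i < l) @grad_Mult R n (r i) 'X^n (beta i)).
Proof.
move=> sr sr1 per disj; pose G i j := (@grad_Mult R n (r i) 'X^n (beta i)) 0 j.
have r0 i : (0 < r i)%N by case: (per i).
have beta_per i : iter (r i) (horner 'X^n) (beta i) = beta i by case: (per i).
apply: inj_row_free => u /rowP uG.
have {uG} uG j : \sum_i u 0 i * G i j = 0.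
  transitivity ((0 : 'rV[C]_n) 0 j); last by rewrite mxE.
  by rewrite -uG mxE; apply: eq_bigr => i _; rewrite /G [in RHS]mxE.
have u_neq0 i0 : beta i0 != 0 -> u 0 i0 = 0.
  move=> bi0.
  pose pts :=
    flatten [seq traject (horner 'X^n) (beta i) (r i) | i <- enum 'I_l].
  pose e : nat := [exists i, beta i == 0].
  (* Only the point [beta i0] is left out, so [q] also vanishes on the rest of its own orbit. *)
  pose q := 'X^e * \prod_(z <- [seq z <- pts | z != beta i0]) ('X - z%:P).
  have ptsP i k : (k < r i)%N -> iter k (horner 'X^n) (beta i) \in pts.
    move=> kr; apply/flattenP; exists (traject (horner 'X^n) (beta i) (r i)).
      by apply: map_f; rewrite mem_enum.
    by apply/trajectP; exists k.
  have q_root i k : (k < r i)%N -> iter k (horner 'X^n) (beta i) != beta i0 ->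
      q.[iter k (horner 'X^n) (beta i)] = 0.
    move=> kr ne; apply/rootP; rewrite /q rootM root_prod_XsubC mem_filter ne.
    by rewrite ptsP// orbT.
  have sq : (size q <= n)%N.
    rewrite /q mulrC size_mulXn ?monic_neq0 ?monic_prod_XsubC//.
    rewrite size_prod_XsubC size_filter.
    have sp : size pts = (\sum_(i < l) r i)%N.
      rewrite size_flatten /shape -map_comp sumnE big_map big_enum/=.
      by apply: eq_bigr => i _; rewrite /= size_traject.
    have cp : (count (fun z => z != beta i0) pts < size pts)%N.
      rewrite -(count_predC (fun z => z != beta i0)) -[X in (X < _)%N]addn0.
      rewrite ltn_add2l -has_count; apply/hasP; exists (beta i0).
        exact: (ptsP i0 0).
      by rewrite /= eqxx.
    (* The extra factor ['X] is present only if some [beta i] is 0; then [r i = 1], and the strict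
       bound on the sum of periods makes room for it. *)
    rewrite sp in cp; rewrite /e; case: existsP => [[i /eqP bi]|_] /=.
      rewrite add1n; apply: leq_ltn_trans cp (sr1 _); exists i.
      by apply: exact_period_Xn0; rewrite -bi.
    by rewrite add0n; exact: leq_trans cp sr.
  have : \sum_i u 0 i * (\sum_(j < n) q`_j * (G i j / (j%:R / n%:R - 1))) = 0.
    under eq_bigr do rewrite mulr_sumr.
    rewrite exchange_big/= big1// => j _.
    rewrite (eq_bigr (fun i => (q`_j / (j%:R / n%:R - 1)) * (u 0 i * G i j))).
      by rewrite -mulr_sumr uG mulr0.
    by move=> i _; ring.
  rewrite (bigD1 i0)//= [X in _ + X]big1 ?addr0.
    rewrite sum_coef_grad_Mult_Xn//.
    rewrite [X in _ * (_ * X)](bigD1 (Ordinal (r0 i0)))//=.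
    rewrite [X in _ * (_ * (_ + X))]big1 ?addr0.
      have n0 : (n%:R : C) != 0 by rewrite pnatr_eq0 -lt0n (ltn_trans _ n_gt2).
      have M0 : \prod_(k < r i0) (n%:R * iter k (horner 'X^n) (beta i0) ^+ n.-1)
          != 0.
        apply/prodf_neq0 => k _.
        by rewrite mulf_neq0// expf_neq0// iter_Xn expf_neq0.
      have q0 : q.[beta i0] != 0.
        rewrite /q hornerM hornerXn mulf_neq0 ?expf_neq0//.
        by rewrite -[_ != _]/(~~ root _ _) root_prod_XsubC mem_filter eqxx.
      move/eqP; rewrite !mulf_eq0 (negPf M0) (negPf q0) invr_eq0.
      by rewrite (negPf (expf_neq0 _ bi0)) !orbF => /eqP.
    move=> k k0; rewrite q_root ?mul0r//.
    have [_ _ +] := per i0; apply; rewrite ltn_ord andbT lt0n.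
    by apply: contraNneq k0 => k0; apply/eqP/val_inj.
  move=> i ii0; have [bi|bi] := eqVneq (beta i) 0.
    have ri : r i = 1%N by apply: exact_period_Xn0; rewrite -bi.
    (* Since 0 is a listed point other than [beta i0], the product already vanishes at 0; with the
       factor ['X], [q] is divisible by ['X^2]. *)
    have q1 : q`_1 = 0.
      rewrite /q coefXnM; have -> : e = 1%N.
        by rewrite /e; case: existsP => // -[]; exists i; rewrite bi.
      rewrite /= subnn -horner_coef0; apply/rootP.
      rewrite root_prod_XsubC mem_filter eq_sym bi0/= -bi.
      exact: (ptsP i 0).
    rewrite big1 ?mulr0// => j _; rewrite /G grad_Mult_Xn_0//.
    by case: eqP => [->|_]; rewrite ?q1 ?mul0r ?mulr0.
  (* A point of this orbit equal to [beta i0] would make the two orbits coincide, so all its points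
     are roots of [q]. *)
  rewrite sum_coef_grad_Mult_Xn// [X in _ * (_ * X)]big1 ?mulr0// => k _.
  rewrite q_root ?mul0r//; apply/eqP => E; apply: (disj _ _ ii0).
  by rewrite -E (forward_orbit_iter _ (r0 i)).
apply/rowP => i0; rewrite mxE.
have [bi0|/u_neq0//] := eqVneq (beta i0) 0.
(* What remains is the coefficient at the fixed point 0, read off in the coordinate [a_1];
   disjointness allows only one index with [beta i = 0]. *)
have := uG (Ordinal (ltn_trans (isT : (1 < 2)%N) n_gt2)).
rewrite (bigD1 i0)//= big1 ?addr0.
  rewrite /G grad_Mult_Xn_0// ?mulr1//.
  by apply: exact_period_Xn0; rewrite -bi0.
move=> i ii0; rewrite u_neq0 ?mul0r//; apply/eqP => bi.
by apply: (disj _ _ ii0); rewrite bi bi0.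
Qed.

End Independence.

Theorem theorem1p6 (R : realType) (n l : nat) (r : 'I_l -> nat)
    (hn : (3 <= n)%N) (hl : (0 < l)%N) (hr : forall i, (0 < r i)%N)
    (hsum : (\sum_(i < l) r i <= n)%N)
    (hsum1 : (exists j, r j = 1%N) -> (\sum_(i < l) r i < n)%N) :
  Z0 n r ('X^n : {poly cplx R}) /\ @Z0 R n l r !=set0.
Proof.
suff Z0Xn : Z0 n r ('X^n : {poly cplx R}) by split=> //; exists 'X^n.
split; first by move=> i _; exact: Zset_Xn.
by move=> beta per disj; exact: row_free_grad_Mult_Xn.
Qed.
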